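(* The number of strongly-connected word-graphs among the word-graphs represented by $\ell$-words over an $n$-alphabet is $\varphi(\ell,n) = n!\,T(\ell,n)$, where $$T(\ell, n) = \left\{ \ell-1 \atop n \right\} + \sum_{j=0}^{\ell-2} \sum_{m=0}^{n-2} \left\{ j \atop m \right\} T(\ell-j-1, n-m)\,(n-m-1),$$ with base cases $T(\ell,n)=0$ for $\ell\le 0$ or $\ell\le n$, and $T(\ell,1)=1$. Here $\left\{ a \atop b \right\}$ denotes the Stirling number of the second kind (the number of partitions of an $a$-set into $b$ nonempty subsets).
   Context: An $\ell$-word $\omega=\omega_1\ldots\omega_\ell$ over an $n$-alphabet uses exactly $n$ distinct letters, with $\ell>n>0$. The word-graph $G_\omega$ is the simple digraph with vertex set the alphabet of $\omega$ and directed edge set $\{(\omega_i,\omega_{i+1}) : 1\le i<\ell,\ \omega_i\neq\omega_{i+1}\}$. The family of word-graphs considered consists of the $G_\omega$ for all $\ell$-words $\omega$ over an $n$-alphabet (there are $n!\left\{ \ell \atop n \right\}$ such words, counted with multiplicity one per word). A digraph is strongly-connected if there is a directed path from every vertex to every other vertex. *)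

(* Defs.v *)
From mathcomp Require Import all_boot.
Set Implicit Arguments.
Unset Strict Implicit.
Unset Printing Implicit Defensive.

Definition stirling2 (a b : nat) : nat :=
  #|[set P : {set {set 'I_a}} | partition P [set: 'I_a] & #|P| == b]|.

Definition uses_all_letters (A : finType) (l : nat) (w : l.-tuple A) : bool :=
  [forall a : A, a \in w].

Definition word_graph (A : finType) (l : nat) (w : l.-tuple A) : rel A :=
  fun x y => (x != y) &&
    [exists i : 'I_l, exists j : 'I_l,
       [&& j == i.+1 :> nat, tnth w i == x & tnth w j == y]].

Definition strongly_connected (V : finType) (e : rel V) : bool :=
  [forall x : V, forall y : V, connect e x y].

(* The recurrence for T(l, n) with a recursion bound k; the bound plays no    *)
(* role as soon as l <= k (Trec_bound), and T satisfies the unbounded         *)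
(* recurrence (T_eq0, T_eq1, T_rec).                                          *)
(* The base case l <= n takes precedence over n = 1, so that T 1 1 = 0; the   *)
(* recursive calls only use n - m >= 2, so T 1 1 affects no other value.      *)
Fixpoint Trec (k l n : nat) : nat :=
  if k is k'.+1 then
    if l <= n then 0
    else if n == 1 then 1
    else stirling2 (l - 1) n +
         \sum_(0 <= j < l - 1) \sum_(0 <= m < n - 1)
           stirling2 j m * Trec k' (l - j - 1) (n - m) * (n - m - 1)
  else 0.

Definition T (l n : nat) : nat := Trec l l n.

Lemma Trec_bound (k k' l n : nat) :
  l <= k -> l <= k' -> Trec k l n = Trec k' l n.
Proof.
elim: k k' l n => [|k IH] [|k'] l n //=.
- by rewrite leqn0 => /eqP ->.
- by rewrite leqn0 => _ /eqP ->.
move=> lk lk'; case: leqP => // ltnl; case: eqP => // _; congr (_ + _).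
apply: eq_big_nat => j _; apply: eq_big_nat => m _; congr (_ * _ * _).
have bnd q : l <= q.+1 -> l - j - 1 <= q.
  by move=> lq; rewrite -subnDA addn1 leq_subLR addSn (leq_trans lq) ?ltnS ?leq_addl.
by apply: IH; apply: bnd.
Qed.

Lemma T_eq0 (l n : nat) : l <= n -> T l n = 0.
Proof. by rewrite /T; case: l => //= l ->. Qed.

Lemma T_eq1 (l : nat) : 1 < l -> T l 1 = 1.
Proof. by case: l => [|[|l]]. Qed.

Lemma T_rec (l n : nat) : n < l -> n != 1 ->
  T l n = stirling2 (l - 1) n +
          \sum_(0 <= j < l - 1) \sum_(0 <= m < n - 1)
            stirling2 j m * T (l - j - 1) (n - m) * (n - m - 1).
Proof.
rewrite {1}/T; case: l => // l ltnl n_neq1 /=.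
rewrite leqNgt ltnl /= (negbTE n_neq1); congr (_ + _).
apply: eq_big_nat => j _; apply: eq_big_nat => m _; congr (_ * _ * _).
apply: Trec_bound => //.
by rewrite -subnDA addn1 subSS leq_subr.
Qed.

(* Main.v *)
(** A word is a walk through all its letters, so its word-graph is strongly
    connected iff the last letter reaches the first one ([closes]).  Let the
    word be [x :: t].  If [x] is the last letter of [t], then [t] is an arbitrary
    word using all letters, which gives the Stirling term.  Otherwise split
    [t = u ++ v] where the walk [t] enters its terminal strong component: this
    is the only cut such that [u] and [v] share no letter and [v] closes.
    Paths to [x] never need the edge leaving [x], so [x :: t] closes iff [x] is a
    letter of [v]; as [x] is not the last one, it has [n - m - 1] possible values,
    where [m] is the number of letters of [u]. *)

Require Import Defs.
From mathcomp Require Import all_boot.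
From mathcomp Require Import zify.
Set Implicit Arguments.
Unset Strict Implicit.
Unset Printing Implicit Defensive.

(** * Reachability along a word *)

(** Unlike in [word_graph], a doubled letter gives a loop here; [connect] does not see the
    difference. *)
Definition consecutive (A : eqType) (s : seq A) : rel A :=
  fun x y => (x, y) \in zip s (behead s).

Definition closes (A : finType) (s : seq A) : bool :=
  if s is x :: t then connect (consecutive s) (last x t) x else false.

Arguments closes : simpl never.

Lemma consecutive_cons (A : eqType) (x y : A) (t : seq A) (a b : A) :
  consecutive [:: x, y & t] a b
    = ((a == x) && (b == y)) || consecutive (y :: t) a b.
Proof. by rewrite /consecutive /= inE xpair_eqE. Qed.

Lemma consecutive_mem (A : eqType) (s : seq A) (a b : A) :
  consecutive s a b -> (a \in s) && (b \in s).
Proof.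
elim: s => [|x [|y t] IH] //; rewrite consecutive_cons => /orP[/andP[/eqP-> /eqP->]|/IH].
  by rewrite !inE !eqxx orbT.
by case/andP=> at_ bt; rewrite !(in_cons x) at_ bt !orbT.
Qed.

(** The pair straddling the junction starts at the last letter of [u], so it falls under the first
    alternative. *)
Lemma consecutive_cat (A : eqType) (u v : seq A) (a b : A) :
  consecutive (u ++ v) a b -> (a \in u) || consecutive v a b.
Proof.
elim: u => [|x u IH] //=; case: (u ++ v) IH => [|y t] IH //.
rewrite consecutive_cons => /orP[/andP[/eqP-> _]|/IH]; first by rewrite mem_head.
by rewrite in_cons -orbA => ->; rewrite orbT.
Qed.

Lemma sub_consecutive_catr (A : eqType) (u v : seq A) (a b : A) :
  consecutive v a b -> consecutive (u ++ v) a b.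
Proof.
elim: u => [|x u IH] //= /IH; case: (u ++ v) => [|y t] // ab.
by rewrite consecutive_cons ab orbT.
Qed.

Lemma connect_catr (A : finType) (u v : seq A) (a b : A) :
  connect (consecutive v) a b -> connect (consecutive (u ++ v)) a b.
Proof.
by apply: connect_sub => {}a {}b ab; apply/connect1/sub_consecutive_catr.
Qed.

Lemma connect_head (A : finType) (x y : A) (t : seq A) :
  y \in x :: t -> connect (consecutive (x :: t)) x y.
Proof.
elim: t x => [|z t IH] x; first by rewrite inE => /eqP->; apply: connect0.
rewrite in_cons => /predU1P[->|/IH zy]; first exact: connect0.
apply: (connect_trans (y := z)).
  by apply: connect1; rewrite consecutive_cons !eqxx.
exact: (connect_catr [:: x]).
Qed.

Lemma connect_last (A : finType) (x y : A) (t : seq A) :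
  y \in x :: t -> connect (consecutive (x :: t)) y (last x t).
Proof.
elim: t x => [|z t IH] x; first by rewrite inE => /eqP->; apply: connect0.
rewrite in_cons => /predU1P[->|/IH zy]; first by apply: connect_head; rewrite mem_last.
exact: (connect_catr [:: x]).
Qed.

(* A path ending at [x] can be cut at its first visit to [x], so the edge that
   the first letter [x] contributes is never needed. *)
Lemma connect_cons (A : finType) (x : A) (t : seq A) (z : A) :
  connect (consecutive (x :: t)) z x = connect (consecutive t) z x.
Proof.
apply/idP/idP; last exact: (connect_catr [:: x]).
case/connectP=> p; elim: p z => [|y p IH] z /=; first by move=> _ ->; apply: connect0.
case/andP=> zy /IH{IH} yx /yx{}yx.
have [->|zNx] := eqVneq z x; first exact: connect0.
apply: connect_trans yx; apply: connect1.
by have := consecutive_cat (u := [:: x]) zy; rewrite inE (negPf zNx).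
Qed.

Lemma connect_closed (A : finType) (e : rel A) (P : pred A) :
  (forall a b, P a -> e a b -> P b) -> forall a b, P a -> connect e a b -> P b.
Proof.
move=> Pe a b Pa /connectP[p]; elim: p a Pa => [|c p IH] a Pa /=; first by move=> _ ->.
by case/andP=> /(Pe _ _ Pa) Pc; apply: IH.
Qed.

Lemma connect_mem (A : finType) (t : seq A) (a b : A) :
  a \in t -> connect (consecutive t) a b -> b \in t.
Proof.
by apply: (connect_closed (P := [in t])) => {}a {}b _ /consecutive_mem/andP[].
Qed.

Lemma closes_cons (A : finType) (x y : A) (t : seq A) :
  closes [:: x, y & t] = connect (consecutive (y :: t)) (last y t) x.
Proof. exact: connect_cons. Qed.

Lemma closes_cons_mem (A : finType) (x y : A) (t : seq A) :
  closes [:: x, y & t] -> x \in y :: t.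
Proof. by rewrite closes_cons; apply: connect_mem; rewrite mem_last. Qed.

(** * The terminal strong component of a walk *)

(** Only pairs inside [h :: v] start at a letter of [h :: v], so no edge leaves this set. Conversely
    the last letter reaches [h], and [h] reaches everything after it. *)
Lemma connect_closed_suffix (A : finType) (u : seq A) (h : A) (v : seq A) (x : A) :
  ~~ has [in h :: v] u -> closes (h :: v) ->
  connect (consecutive (u ++ h :: v)) (last h v) x = (x \in h :: v).
Proof.
move=> /hasPn uv zh; apply/idP/idP; last first.
  by move=> xv; apply/connect_catr/(connect_trans zh)/connect_head.
apply: (connect_closed (P := [in h :: v])); last exact: mem_last.
move=> a b av /consecutive_cat/orP[/uv|/consecutive_mem/andP[] //].
by move: av => /= ->.
Qed.

(* The cut is where the walk enters the terminal strong component. *)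
Lemma closed_suffixE (A : finType) (y : A) (t : seq A) (j : nat) :
  j < (size t).+1 ->
  ~~ has [in drop j (y :: t)] (take j (y :: t)) && closes (drop j (y :: t))
    = (j == find (connect (consecutive (y :: t)) (last y t)) (y :: t)).
Proof.
set s := y :: t => j_lt; set z := last y t; set R := connect _ z.
have cat_s := cat_take_drop j s.
set u := take j s in cat_s *; set v := drop j s in cat_s *.
have size_u : size u = j by rewrite size_takel // ltnW.
have [h [v' v_def]] : exists h v', v = h :: v'.
  have : size v != 0 by rewrite size_drop subn_eq0 -ltnNge.
  by case: v {cat_s} => // h v' _; exists h, v'.
have last_v : last h v' = z.
  have -> : z = last y s by [].
  by rewrite -cat_s last_cat v_def.
apply/idP/eqP.
  case/andP; rewrite v_def => uv hv.
  (* The letters reachable from the end are those of [v]; none occurs in [u], so the first one sits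
     at position [size u = j]. *)
  have RE a : R a = (a \in v).
    by rewrite /R -cat_s v_def -last_v connect_closed_suffix.
  rewrite -cat_s find_cat size_u (eq_has RE) v_def (negPf uv) /=.
  by rewrite RE v_def mem_head addn0.
move=> j_def.
have uNR a : a \in u -> ~~ R a.
  move=> /(nthP y)[i]; rewrite size_u => i_lt <-.
  by rewrite nth_take // before_find // -j_def.
have Rh : R h.
  have -> : h = nth y s j by rewrite -[j]addn0 -nth_drop -/v v_def.
  rewrite j_def; apply: nth_find.
  by apply/hasP; exists z; [rewrite mem_last | apply: connect0].
apply/andP; split.
  apply/hasPn => a /uNR; apply: contra; rewrite /= v_def => av.
  apply: connect_trans Rh _; rewrite -cat_s v_def.
  exact/connect_catr/connect_head.
rewrite v_def /closes -v_def last_v.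
(* A path from [z] visits only letters reachable from [z]. None of them lies in [u], so every edge
   of the path already comes from [v]. *)
have : R h && connect (consecutive v) z h; last by case/andP.
apply: (connect_closed (P := fun a => R a && connect (consecutive v) z a) _ _ Rh).
  move=> a b /andP[Ra za] ab; rewrite /R (connect_trans Ra (connect1 ab)) /=.
  apply: connect_trans za (connect1 _).
  move: ab; rewrite -cat_s => /consecutive_cat/orP[/uNR|//].
  by rewrite Ra.
by rewrite /R !connect0.
Qed.

(** By [closed_suffixE] a single cut [j] can contribute, and for that cut [x] is reachable from the
    last letter iff it lies in the suffix. *)
Lemma closes_cons_sum (A : finType) (x y : A) (t : seq A) :
  closes [:: x, y & t] =
    \sum_(j < (size t).+1)
      [&& ~~ has [in drop j (y :: t)] (take j (y :: t)),
          closes (drop j (y :: t)) & x \in drop j (y :: t)] :> nat.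
Proof.
set s := y :: t; set z := last y t; set R := connect (consecutive s) z.
have hasR : has R s by apply/hasP; exists z; [rewrite mem_last | apply: connect0].
have [k k_lt k_def] : exists2 k, k < (size t).+1 & k = find R s.
  by exists (find R s) => //; rewrite has_find in hasR.
rewrite closes_cons -/s -/z (bigD1 (Ordinal k_lt)) //= big1 => [|j]; last first.
  by rewrite -(inj_eq val_inj) andbA closed_suffixE // -k_def => /negPf->.
have := closed_suffixE y k_lt; rewrite -/s -/z -/R -k_def eqxx => cut.
rewrite addn0 andbA cut /= -/s; have /andP[] := cut.
have cat_s := cat_take_drop k s; rewrite (drop_nth y) // in cat_s *.
have z_def : z = last (nth y s k) (drop k.+1 s).
  by rewrite -[z]/(last y s) -[in LHS]cat_s last_cat.
by move=> uv hv; rewrite /R z_def -{1}cat_s connect_closed_suffix.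
Qed.

(** * Counting words *)

(** The predicate lives on [seq A], so that it applies to tails, prefixes and suffixes without
    length casts. *)
Definition count_words (A : finType) (l : nat) (P : pred (seq A)) : nat :=
  \sum_(w : l.-tuple A) P w.

Lemma card_count_words (A : finType) (l : nat) (P : pred (seq A)) :
  #|[set w : l.-tuple A | P w]| = count_words l P.
Proof.
by rewrite -sum1_card big_mkcond; apply: eq_bigr => w _; rewrite inE; case: (P w).
Qed.

Lemma count_words0 (A : finType) (P : pred (seq A)) : count_words 0 P = P [::].
Proof.
rewrite /count_words (big_pred1 [tuple]) // => w /=.
by rewrite tuple0; symmetry; apply/eqP; apply: tuple0.
Qed.

Lemma count_wordsS (A : finType) (l : nat) (P : pred (seq A)) :
  count_words l.+1 P = \sum_x count_words l (fun t => P (x :: t)).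
Proof.
rewrite /count_words pair_bigA /=.
rewrite (reindex (fun p : A * l.-tuple A => cons_tuple p.1 p.2)) //=.
exists (fun w : l.+1.-tuple A => (thead w, behead_tuple w)) => [[x t] _|w _].
  by congr (_, _); apply: val_inj.
by rewrite [RHS]tuple_eta; apply: val_inj.
Qed.

Lemma count_words_split (A : finType) (j k : nat) (P Q : pred (seq A)) :
  count_words (j + k) (fun s => P (take j s) && Q (drop j s))
    = count_words j P * count_words k Q.
Proof.
elim: j P => [|j IH] P.
  rewrite count_words0 big_distrr; apply: eq_bigr => w _.
  by rewrite take0 drop0 /= mulnb.
by rewrite addSn !count_wordsS big_distrl; apply: eq_bigr => x _ /=; rewrite -IH.
Qed.

(** * Words with a prescribed letter set, and Stirling numbers *)

Lemma card_preim_partition (T : finType) (A : finType) (f : T -> A) (D : {set T}) :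
  #|preim_partition f D| = #|f @: D|.
Proof.
have -> : preim_partition f D = (fun c => [set y in D | c == f y]) @: (f @: D).
  by rewrite -imset_comp.
rewrite card_in_imset // => _ _ /imsetP[x xD ->] /imsetP[y yD ->] /setP/(_ x).
by rewrite !inE xD eqxx => /esym/eqP.
Qed.

Lemma card_words_partition (A : finType) (l : nat) (B : {set A})
    (P : {set {set 'I_l}}) :
  partition P [set: 'I_l] -> #|P| = #|B| ->
  #|[set w : l.-tuple A | ([set x in w] == B)
                        & preim_partition (tnth w) [set: 'I_l] == P]| = #|B|`!.
Proof.
move=> partP cardP; have /and3P[/eqP covP trivP P0] := partP.
pose blocks : finType := {X : {set 'I_l} | X \in P}.
have card_blocks : #|blocks| = #|B| by rewrite card_sig -cardP; apply: eq_card.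
have blockP i : pblock P i \in P by apply: pblock_mem; rewrite covP inE.
pose block i : blocks := Sub (pblock P i) (blockP i).
have exP (X : blocks) : exists i, i \in val X.
  by apply/set0Pn/eqP => X0; case/negP: P0; rewrite -X0; apply: valP.
(* A chosen position in each block: reading a word there recovers the labelling. *)
pose rep X := xchoose (exP X).
have rep_in X : rep X \in val X := xchooseP (exP X).
have repK X : block (rep X) = X.
  by apply: val_inj => /=; apply: def_pblock (rep_in X); rewrite ?(valP X).
pose inj_on : {set {ffun blocks -> A}} :=
  [set f : {ffun blocks -> A} in ffun_on [in B] | injectiveb f].
have card_inj : #|inj_on| = #|B|`!.
  by rewrite card_inj_ffuns_on card_blocks ffactnn.
pose word (f : {ffun blocks -> A}) := [tuple f (block i) | i < l].
have word_inj : injective word.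
  move=> f g /(congr1 (fun w => tnth w)) fg; apply/ffunP => X.
  by have /(congr1 (fun w => w (rep X))) := fg; rewrite !tnth_mktuple repK.
rewrite -card_inj -(card_imset _ word_inj); apply: eq_card => w.
rewrite inE; apply/andP/imsetP => [[/eqP wB /eqP wP]|[f]].
  have eq_w i j : (j \in pblock P i) = (tnth w i == tnth w j).
    rewrite -wP pblock_equivalence_partition ?inE //.
    by split=> // /eqP->.
  exists [ffun X => tnth w (rep X)].
    rewrite inE; apply/andP; split.
      by apply/ffun_onP => X; rewrite ffunE -wB inE mem_tnth.
    apply/injectiveP => X Y; rewrite !ffunE => /eqP; rewrite -eq_w => YX.
    by rewrite -[X]repK -[Y]repK; apply: val_inj; apply/esym/same_pblock.
  apply: eq_from_tnth => i; rewrite tnth_mktuple ffunE; apply/eqP.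
  by rewrite -eq_w; apply: (rep_in (block i)).
rewrite inE => /andP[/ffun_onP fB /injectiveP f_inj] ->; split.
  (* An injection into a set of the same size is onto, so every letter of [B] is used. *)
  have /eqP imf : f @: setT == B.
    rewrite eqEcard card_imset // cardsT card_blocks leqnn andbT.
    by apply/subsetP => _ /imsetP[X _ ->]; apply: fB.
  rewrite -imf; apply/eqP/setP => c; rewrite inE; apply/idP/imsetP.
    by case/tnthP=> i ->; rewrite tnth_mktuple; exists (block i).
  by case=> X _ ->; apply/tnthP; exists (rep X); rewrite tnth_mktuple repK.
rewrite -[X in _ == X](preim_partition_pblock partP); apply/eqP.
apply: eq_imset => i; apply/setP => j; rewrite !inE /= !tnth_mktuple.
by rewrite (inj_eq f_inj) -val_eqE.
Qed.

(** Words are grouped by the partition of their positions according to the letter carried. *)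
Lemma count_words_letters (A : finType) (l : nat) (B : {set A}) :
  count_words l (fun s => [set x in s] == B) = #|B|`! * stirling2 l #|B|.
Proof.
rewrite -card_count_words -sum1_card.
pose blocks (w : l.-tuple A) := preim_partition (tnth w) [set: 'I_l].
rewrite (partition_big blocks
  [in [set P : {set {set 'I_l}} | partition P [set: 'I_l] & #|P| == #|B|]]) /=.
  rewrite (eq_bigr (fun=> #|B|`!)) => [|P]; first by rewrite sum_nat_const mulnC.
  rewrite inE => /andP[partP /eqP cardP].
  rewrite -(card_words_partition partP cardP) -sum1_card.
  by apply: eq_bigl => w; rewrite !inE.
move=> w; rewrite !inE => /eqP wB; rewrite preim_partitionP card_preim_partition.
rewrite -wB; apply/eqP/eq_card => x; rewrite [RHS]inE.
apply/imsetP/tnthP => [[i _ ->]|[i ->]]; by exists i.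
Qed.

(** * The recurrence for closing words, over letter sets *)

Lemma letters_cons (A : finType) (x : A) (s : seq A) :
  x \in s -> [set z in x :: s] = [set z in s].
Proof. by move=> xs; apply/setP => a; rewrite !inE; case: eqP => // ->. Qed.

(** The first term is [x = last y t], where closing is automatic. In the sum, only the letter set
    [C] of the suffix can contribute, and [#|C| - 1] counts the [x] in it other than the last
    letter. *)
Lemma sum_closes_cons (A : finType) (y : A) (t : seq A) (B : {set A}) :
  \sum_x (([set z in [:: x, y & t]] == B) && closes [:: x, y & t]) =
    ([set z in y :: t] == B) +
    \sum_(j < (size t).+1) \sum_(C : {set A} | C \subset B)
      (([set z in take j (y :: t)] == B :\: C) &&
       (([set z in drop j (y :: t)] == C) && closes (drop j (y :: t)))) *
      (#|C| - 1).
Proof.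
have z_def : last y t = last y (y :: t) by [].
rewrite (bigD1 (last y t)) //= letters_cons ?mem_last //.
rewrite closes_cons connect0 andbT; congr (_ + _).
set s := y :: t; set z := last y t in z_def *.
transitivity (\sum_(x | x != z) \sum_(j < (size t).+1)
    ([set z in s] == B) *
    [&& ~~ has [in drop j s] (take j s), closes (drop j s) & x \in drop j s]).
  apply: eq_bigr => x _; rewrite -big_distrr -closes_cons_sum /=.
  (* If the word closes, [x] recurs in [s] and adds no new letter. *)
  have [cl|] := boolP (closes _); last by rewrite andbF muln0.
  by rewrite andbT muln1 letters_cons // closes_cons_mem.
rewrite exchange_big; apply: eq_bigr => j _ /=.
have cat_s := cat_take_drop j s; set u := take j s in cat_s *.
set v := drop j s in cat_s *; set D := [set a in v].
have z_D : z \in D.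
  rewrite inE z_def -/s -cat_s last_cat.
  have : size v != 0 by rewrite size_drop subn_eq0 -ltnNge.
  by case: (v) => //= h v' _; rewrite mem_last.
transitivity ([&& [set a in s] == B, ~~ has [in v] u & closes v] * (#|D| - 1)).
  rewrite (cardsD1 z) z_D addKn -sum1_card big_distrr /= big_mkcond [RHS]big_mkcond /=.
  apply: eq_bigr => x _; rewrite !inE.
  by case: (x != z) => //=; case: (x \in v); rewrite ?andbT ?andbF ?muln0 // muln1 mulnb.
rewrite big_mkcond (bigD1 D) //= big1 => [|C CD]; last first.
  by rewrite [D == C]eq_sym (negPf CD) andbF if_same.
rewrite addn0 eqxx /= andbA.
(* Both sides say that [B] is the disjoint union of the letter sets of [u] and [v]. *)
suff -> : ([set a in s] == B) && ~~ has [in v] u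
    = (D \subset B) && ([set a in u] == B :\: D).
  by case: (D \subset B).
have -> : [set a in s] = [set a in u] :|: D.
  by apply/setP => a; rewrite -cat_s !inE mem_cat.
apply/andP/andP => [[/eqP<- /hasPn uv]|[DB /eqP uE]].
  split; first exact: subsetUr.
  rewrite setDUl setDv setU0; apply/eqP/esym/setDidPl.
  rewrite disjoint_subset; apply/subsetP => a; rewrite !inE; exact: uv.
split; first by rewrite uE setUC -{1}(setIidPr DB) setID.
apply/hasPn => a au; have : a \in B :\: D by rewrite -uE inE.
by rewrite !inE => /andP[].
Qed.

(** Once [j] and [C] are fixed, the prefix and the suffix of the tail vary independently, so their
    counts multiply. *)
Lemma count_closes_rec (A : finType) (l : nat) (B : {set A}) :
  0 < l ->
  count_words l.+1 (fun s => ([set x in s] == B) && closes s) =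
    count_words l (fun s => [set x in s] == B) +
    \sum_(j < l) \sum_(C : {set A} | C \subset B)
      count_words j (fun s => [set x in s] == B :\: C) *
      count_words (l - j) (fun s => ([set x in s] == C) && closes s) *
      (#|C| - 1).
Proof.
case: l => // l _; rewrite count_wordsS exchange_big /=.
transitivity (\sum_(t : l.+1.-tuple A) (([set z in t] == B) +
    \sum_(j < l.+1) \sum_(C : {set A} | C \subset B)
      (([set z in take j t] == B :\: C) &&
       (([set z in drop j t] == C) && closes (drop j t))) * (#|C| - 1))).
  apply: eq_bigr => t _; case/tupleP: t => y t.
  by have := sum_closes_cons y t B; rewrite size_tuple.
rewrite big_split; congr (_ + _); rewrite exchange_big; apply: eq_bigr => j _ /=.
rewrite exchange_big; apply: eq_bigr => C _ /=.
rewrite -big_distrl -count_words_split subnKC //; exact: ltnW.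
Qed.

(** * From letter sets to the numbers [T] *)

(** The index [m] is the size of the complement of [C], which is the number of letters of the prefix
    in the recurrence. *)
Lemma sum_subsets (A : finType) (B : {set A}) (g : nat -> nat) :
  \sum_(C : {set A} | C \subset B) g #|C|
    = \sum_(m < #|B|.+1) 'C(#|B|, m) * g (#|B| - m).
Proof.
pose size_of (C : {set A}) : 'I_#|B|.+1 := inord (#|B| - #|C|).
rewrite (partition_big size_of predT) //=; apply: eq_bigr => m _.
have m_le : m <= #|B| by rewrite -ltnS.
have eq_size (C : {set A}) : (C \subset B) && (size_of C == m)
    = (C \in [set C : {set A} | C \subset B & #|C| == #|B| - m]).
  rewrite inE; have [CB|//] := boolP (C \subset B).
  rewrite -val_eqE /= inordK ?ltnS ?leq_subr //.
  have := subset_leq_card CB; lia.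
rewrite (eq_bigl _ _ eq_size) (eq_bigr (fun=> g (#|B| - m))) => [|C].
  by rewrite sum_nat_const cards_draws bin_sub.
by rewrite inE => /andP[_ /eqP->].
Qed.

(** Two letters are required: a word of length 1 closes, whereas [T 1 1 = 0]. *)
Lemma count_closes (A : finType) (l : nat) (B : {set A}) :
  1 < #|B| ->
  count_words l (fun s => ([set x in s] == B) && closes s) = #|B|`! * T l #|B|.
Proof.
elim/ltn_ind: l B => l IH B B_gt1; have [l_le|] := leqP l #|B|.
  rewrite T_eq0 // muln0 /count_words big1 // => w _; apply/eqP; rewrite eqb0.
  apply/negP => /andP[/eqP wB].
  have card_le (s : seq A) : #|[set x in s]| <= size s by rewrite cardsE card_size.
  have := size_tuple w; case: (val w) wB => [|x [|y t]] // wB /= size_w.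
    by have := card_le [:: x]; rewrite wB /=; lia.
  (* The first letter recurs, so [y :: t] already carries all of [B], which makes the word longer
     than [#|B|]. *)
  move/closes_cons_mem=> xt; have := card_le (y :: t).
  have -> : [set z in y :: t] = B; last by rewrite /=; lia.
  by rewrite -(letters_cons xt).
case: l IH => // l IH B_lt; have l_gt0 : 0 < l by lia.
rewrite count_closes_rec // T_rec //; last by rewrite gtn_eqF.
rewrite subn1 big_mkord mulnDr count_words_letters; congr (_ + _).
rewrite big_distrr; apply: eq_bigr => j _ /=; have j_lt := ltn_ord j.
pose g b := (#|B| - b)`! * stirling2 j (#|B| - b) * (b`! * T (l - j) b) * (b - 1).
transitivity (\sum_(C : {set A} | C \subset B) g #|C|).
  apply: eq_bigr => C CB; rewrite count_words_letters cardsD (setIidPr CB) /g.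
  (* The induction hypothesis covers only [#|C| > 1]; below that the factor [#|C| - 1] is zero on
     both sides. *)
  have [C_gt1|C_le1] := ltnP 1 #|C|; last first.
    by have /eqP-> : #|C| - 1 == 0 by []; rewrite !muln0.
  by rewrite IH // ltnS leq_subr.
rewrite sum_subsets; case: #|B| B_gt1 @g => [|[|n]] // _ g.
(* The two top values of [m] leave at most one letter to the suffix. They lie outside the range in
   [T_rec], and their terms vanish. *)
have g0 : g (n.+2 - n.+2) = 0 by rewrite subnn /g muln0.
have g1 : g (n.+2 - n.+1) = 0 by rewrite subSnn /g muln0.
rewrite 2!big_ord_recr /= g0 g1 !muln0 !addn0.
rewrite big_mkord big_distrr; apply: eq_bigr => m _ /=.
have m_le : m <= n.+2 by have := ltn_ord m; lia.
have -> : l.+1 - j - 1 = l - j by lia.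
rewrite -(bin_fact m_le) /g subKn //.
move: ('C(_, _)) (m`!) (_`!) (stirling2 _ _) (T _ _) (_ - 1) => *; lia.
Qed.

(** * Back to word-graphs *)

Lemma consecutiveP (A : eqType) (x0 : A) (s : seq A) (a b : A) :
  reflect (exists2 i, i.+1 < size s & nth x0 s i = a /\ nth x0 s i.+1 = b)
    (consecutive s a b).
Proof.
elim: s => [|x [|y t] IH]; [by right; case | by right; case=> -[] |].
rewrite consecutive_cons; apply: (iffP orP) => [[/andP[/eqP-> /eqP->]|/IH[i]]|[[|i]]].
- by exists 0.
- by exists i.+1.
- by move=> _ [/= -> ->]; rewrite !eqxx; left.
- by move=> i_lt ab; right; apply/IH; exists i.
Qed.

Lemma word_graphE (A : finType) (l : nat) (w : l.-tuple A) (x y : A) :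
  word_graph w x y = (x != y) && consecutive w x y.
Proof.
congr (_ && _); apply/existsP/(consecutiveP x).
  case=> i /existsP[j /and3P[/eqP ji]]; rewrite !(tnth_nth x) ji => /eqP wi /eqP wj.
  by exists i; rewrite // size_tuple -ji.
case=> i; rewrite size_tuple => i_lt [wi wj].
exists (Ordinal (ltnW i_lt)); apply/existsP; exists (Ordinal i_lt).
by rewrite !(tnth_nth x) /= wi wj !eqxx.
Qed.

Lemma connect_word_graph (A : finType) (l : nat) (w : l.-tuple A) :
  connect (word_graph w) =2 connect (consecutive w).
Proof.
move=> a b; apply/idP/idP; apply: connect_sub => {}a {}b.
  by rewrite word_graphE => /andP[_]; apply: connect1.
have [->|aNb ab] := eqVneq a b; first by rewrite connect0.
by apply: connect1; rewrite word_graphE aNb.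
Qed.

Lemma strongly_connected_closes (A : finType) (l : nat) (w : l.-tuple A) :
  0 < l -> uses_all_letters w ->
  strongly_connected (word_graph w) = closes w.
Proof.
move=> l_gt0 /forallP all_w.
have [x [t w_def]] : exists x t, tval w = x :: t.
  have : 0 < size w by rewrite size_tuple.
  by case: (tval w) => // x t _; exists x, t.
rewrite /closes w_def -w_def.
apply/forallP/idP => [/(_ (last x t))/forallP/(_ x)|zx a].
  by rewrite connect_word_graph.
apply/forallP => b; rewrite connect_word_graph.
have mem_w c : c \in x :: t by rewrite -w_def; apply: all_w.
(* Walk forward from [a] to the last letter, return to the first by [zx], then walk forward to
   [b]. *)
move: zx; rewrite w_def => zx; apply: connect_trans (connect_last (mem_w a)) _.
exact: connect_trans zx (connect_head (mem_w b)).
Qed.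

Theorem theorem4 (A : finType) (n l : nat) (cardA : #|A| = n)
    (n_gt0 : 0 < n) (n_lt_l : n < l) :
  #|[set w : l.-tuple A | uses_all_letters w
                        & strongly_connected (word_graph w)]| = n`! * T l n.
Proof.
(* [count_closes] needs two letters. Over a one-letter alphabet every word qualifies, and there are
   [1 ^ l = 1] of them. *)
have [n_gt1|n_le1] := ltnP 1 n; last first.
  have n1 : n = 1 by lia.
  have A1 (a b : A) : a = b.
    by apply: (fintype_le1P _) => //; rewrite cardA n1.
  rewrite n1 T_eq1 ?muln1; last by lia.
  rewrite -[RHS](exp1n l) -n1 -cardA -card_tuple -cardsT; apply: eq_card => w.
  rewrite !inE; apply/andP; split.
    have i : 'I_l by apply: (@Ordinal _ 0); lia.
    by apply/forallP => a; rewrite (A1 a (tnth w i)) mem_tnth.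
  by apply/forallP => a; apply/forallP => b; rewrite (A1 a b) connect0.
rewrite -cardA -cardsT -count_closes ?cardsT ?cardA // -card_count_words.
apply: eq_card => w; rewrite !inE.
have -> : ([set x in w] == [set: A]) = uses_all_letters w.
  apply/eqP/forallP => [/setP w_all x|w_all].
    by have := w_all x; rewrite !inE.
  by apply/setP => x; rewrite !inE w_all.
have [all_w|//] := boolP (uses_all_letters w).
by rewrite strongly_connected_closes //; lia.
Qed.
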